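(* Let $G$ be an infinite finitely generated group, let $S$ be a finite symmetric generating set of $G$ (that is, $e\in S$ and $S^{-1}=S$), and suppose that the Cayley graph $C(G,S)$ is $\delta$-hyperbolic for some $\delta\ge 0$. Let $c_0>1$ be a constant such that for every $g\in G$ there is $g'\in G$ with $d(g,g')\le c_0$ and $|g'|=|g|+1$, and let $D\ge 0$ be a constant such that every $c_0$-quasigeodesic segment in $C(G,S)$ is within Hausdorff distance at most $D$ of every geodesic segment of $C(G,S)$ with the same endpoints. For $\lambda\in(0,1)$ and $\epsilon>0$ put $$\tau(\lambda)=\frac{4(D+\delta)}{1-\lambda},\qquad \mu(\lambda,\epsilon)=\frac{\lambda\epsilon}{c_0-1}.$$ Then the topological entropy $h(G,S;\partial G)$ of $G$ (with respect to $S$) acting on its ideal boundary $\partial G$ satisfies $$\operatorname{gr}^{\mathrm{rel}}(G,S;\mu,\tau)\ \le\ h(G,S;\partial G)\ \le\ \operatorname{gr}(G,S),$$ where $\operatorname{gr}(G,S)$ is the exponential rate of growth of $G$ with respect to $S$ and $\operatorname{gr}^{\mathrm{rel}}(G,S;\mu,\tau)$ is the exponential rate of growth of $G$ relative to $\mu$ and $\tau$.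
   Context: **Word metric.** $|\cdot|$ is the word length on $G$ with respect to $S$, and $d(g_1,g_2)=|g_1^{-1}g_2|$. $C(G,S)$ is the Cayley graph, with the path metric $d$ extending the word metric and making each edge isometric to a Euclidean segment of length 1. $G$ acts on $C(G,S)$ by isometries extending the left translations $h\mapsto gh$. Put $B(n)=\{g\in G: |g|\le n\}$ and $S(n)=\{g\in G:|g|=n\}$. **Growth.** $\operatorname{gr}(G,S)=\lim_{n\to\infty}\frac1n\log \# B(n)$. **Relative growth.** For $m\in\mathbb N$ (positive), $\epsilon>0$, $\lambda\in(0,1)$, let $N_0(n;m,\epsilon,\lambda)$ be the maximal cardinality of a subset $A\subset S(mn)$ with the following property: for any two distinct $x,y\in A$ there exist sequences $(x_0,x_1,\dots,x_n)$ and $(y_0,y_1,\dots,y_n)$ of elements of $G$ such that $x_k,y_k\in S(km)$ for all $k$, $x_0=y_0=e$, $x_n=x$, $y_n=y$, $d(x_j,x_{j+1})\le m+\lambda\epsilon$ and $d(y_j,y_{j+1})\le m+\lambda\epsilon$ for all $0\le j<n$, and $d(x_{k+1},y_{k+1})\ge\epsilon$, where $k$ is the maximal index with $x_k=y_k$. Put $$\operatorname{gr}^{\mathrm{rel}}(G,S;m,\epsilon,\lambda)=\limsup_{n\to\infty}\frac1{mn}\log N_0(n;m,\epsilon,\lambda),$$ $$\operatorname{gr}^{\mathrm{rel}}(G,S;\mu,\tau)=\sup\{\operatorname{gr}^{\mathrm{rel}}(G,S;m,\epsilon,\lambda): \lambda\in(0,1),\ \epsilon>\tau(\lambda),\ m\in\mathbb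 N,\ m>\mu(\lambda,\epsilon)\}.$$ **Hyperbolicity.** In a metric space $(X,d)$ the Gromov product is $(y|z)_{x_0}=\frac12(d(x_0,y)+d(x_0,z)-d(y,z))$. $X$ is $\delta$-hyperbolic if $(x|z)_{x_0}\ge\min\{(x|y)_{x_0},(y|z)_{x_0}\}-\delta$ for all $x_0,x,y,z\in X$. A geodesic segment is a map $\gamma:[a,b]\to X$ with $d(\gamma(s),\gamma(t))=|s-t|$. A $c$-quasigeodesic segment ($c\ge1$) is a map $\gamma$ from $[a,b]$ (or from $[a,b]\cap\mathbb Z$, with $a,b\in\mathbb Z$) to $X$ such that $\frac1c|s-t|-c\le d(\gamma(s),\gamma(t))\le c|s-t|+c$ for all $s,t$ in the domain. Constants $c_0$ and $D$ as in the statement are known to exist for infinite hyperbolic groups. **Boundary.** Let $X=C(G,S)$ with base point $e$, and write $(\cdot|\cdot)=(\cdot|\cdot)_e$. A sequence $(x_n)$ in $X$ diverges to infinity if $(x_m|x_n)\to\infty$ as $m,n\to\infty$; two such sequences $(x_n),(y_n)$ are equivalent if $(x_m|y_n)\to\infty$ as $m,n\to\infty$. $\partial G=\partial C(G,S)$ is the set of equivalence classes. For $\xi,\zeta\in\partial G$ put $(\xi|\zeta)=\sup\liminf_{m,n\to\infty}(x_m|y_n)$, the supremum over all sequences $(x_m)$, $(y_n)$ representing $\xi$, $\zeta$. For $\eta>0$ put $\rho_\eta(\xi,\zeta)=\exp(-\eta(\xi|\zeta))$ (with $e^{-\infty}=0$) and $$d_\eta(\xi,\zeta)=\inf\Big\{\sum_{i=0}^k\rho_\eta(\xi_i,\xi_{i+1}):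 k\in\mathbb N,\ \xi_i\in\partial G,\ \xi_0=\xi,\ \xi_{k+1}=\zeta\Big\}.$$ For all sufficiently small $\eta>0$ (depending on $\delta$), $d_\eta$ is a distance function, $(\partial G,d_\eta)$ is compact, and $(1-2\eta')\rho_\eta\le d_\eta\le\rho_\eta$ with $\eta'=e^{\eta\delta}-1<\frac12$. Such an $\eta$ is fixed and $\partial G$ carries the metric $d_\eta$. $G$ acts on $\partial G$ by homeomorphisms $L_g$, where $L_g$ sends the class of $(x_n)$ to the class of $(gx_n)$. **Entropy.** Points $\xi,\zeta\in\partial G$ are $(n,\theta)$-separated ($\theta>0$, $n\in\mathbb N$) if $d_\eta(L_g\xi,L_g\zeta)\ge\theta$ for some $g\in B(n)$. Let $N(n,\theta;\partial G)$ be the maximal number of pairwise $(n,\theta)$-separated points of $\partial G$. Then $$h(G,S;\partial G)=\lim_{\theta\to0}\limsup_{n\to\infty}\frac1n\log N(n,\theta;\partial G).$$ *)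

(* Defs.v *)
From HB Require Import structures.
From mathcomp Require Import all_boot all_order all_algebra finmap.
From mathcomp Require Import all_classical all_reals all_analysis.
Import Order.TTheory GRing.Theory Num.Theory.
Import numFieldNormedType.Exports.
Set Implicit Arguments.
Unset Strict Implicit.
Unset Printing Implicit Defensive.
Local Open Scope classical_set_scope.
Local Open Scope ring_scope.

Section GeneralMetric.
Context {R : realType}.

(* The supremum of the cardinalities of the finite sets satisfying P, as an
   extended real. *)
Definition sup_card (T : Type) (P : set (set T)) : \bar R :=
  ereal_sup [set (k%:R)%:E | k in [set k | exists2 A, P A & (A #= `I_k)%card]].

(* (A, d) is a compact metric space: it is isometric to one of the library's
   metric spaces whose underlying space is compact. *)
Definition compact_metric_space (T : Type) (A : set T) (d : T -> T -> R) : Prop :=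
  exists (M : metricType R) (f : M -> T),
    [/\ set_bij [set: M] A f,
        forall x y, mdist x y = d (f x) (f y) &
        compact [set: M]].

Variables (X : Type) (d : X -> X -> R).

Definition gromov_product (x0 y z : X) : R := (d x0 y + d x0 z - d y z) / 2.

Definition hyperbolic (delta : R) : Prop :=
  forall x0 x y z,
    Num.min (gromov_product x0 x y) (gromov_product x0 y z) - delta
      <= gromov_product x0 x z.

Definition geodesic_segment (a b : R) (gamma : R -> X) : Prop :=
  a <= b /\ {in `[a, b] &, forall s t, d (gamma s) (gamma t) = `|s - t|}.

(* I is the domain of gamma, [a, b] or its set of integer points; the values of
   gamma outside I are irrelevant. *)
Definition quasigeodesic_segment (c a b : R) (I : set R) (gamma : R -> X) : Prop :=
  [/\ a <= b,
      I = `[a, b]%classic \/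
      [/\ a \is a Num.int, b \is a Num.int &
          I = `[a, b]%classic `&` [set t | t \is a Num.int]] &
      forall s t, I s -> I t ->
        c^-1 * `|s - t| - c <= d (gamma s) (gamma t) <= c * `|s - t| + c].

Definition hausdorff_dist (A B : set X) : \bar R :=
  maxe (ereal_sup [set ereal_inf [set (d x y)%:E | y in B] | x in A])
       (ereal_sup [set ereal_inf [set (d x y)%:E | x in A] | y in B]).

Definition stability_constant (c D : R) : Prop :=
  forall a b I gamma a' b' sigma,
    quasigeodesic_segment c a b I gamma ->
    geodesic_segment a' b' sigma ->
    gamma a = sigma a' -> gamma b = sigma b' ->
    (hausdorff_dist (gamma @` I) (sigma @` `[a', b']%classic) <= D%:E)%E.

End GeneralMetric.

Section WordMetric.
Variables (G : groupType) (S : set G).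

Definition symmetric_generating_set : Prop :=
  [/\ S 1%g,
      forall s, S s -> S (s^-1)%g &
      forall g, exists2 w : seq G, {in w, forall s, S s} & (\prod_(s <- w) s)%g = g].

Definition expressible (g : G) : set nat :=
  [set n | exists w : seq G,
     [/\ size w = n, {in w, forall s, S s} & (\prod_(s <- w) s)%g = g]].

Definition word_length (g : G) : nat :=
  xget 0%N [set n | expressible g n /\ forall k, expressible g k -> (n <= k)%N].

Definition word_dist (g h : G) : nat := word_length (g^-1 * h)%g.

Definition word_ball (n : nat) : set G := [set g | (word_length g <= n)%N].

Definition word_sphere (n : nat) : set G := [set g | word_length g = n].

End WordMetric.

(* The Cayley graph is the geometric realization of the 1-dimensional complex
   with vertex set G and one edge {g, h} whenever g <> h and g^-1 h \in S: a
   point is given by its barycentric coordinates, a function G -> R supported on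
   a vertex or on an edge.  The degenerate case g = h of on_edge is the vertex g,
   so e \in S creates no loops. *)
Section CayleyGraph.
Context {R : realType}.
Variables (G : groupType) (S : set G).

Definition on_edge (g h : G) (x : G -> R) : Prop :=
  (g = h \/ S (g^-1 * h)%g) /\
  exists2 t : R, 0 <= t <= 1 &
    forall k, x k = (1 - t) * (k == g)%:R + t * (k == h)%:R.

Definition cayley_graph : Type := {x : G -> R | exists g h, on_edge g h x}.

(* l is the distance between x and y along a closed edge containing both. *)
Definition edge_step (x y : cayley_graph) (l : R) : Prop :=
  exists g h, [/\ on_edge g h (sval x), on_edge g h (sval y) &
                  l = `|sval x g - sval y g|].

Definition path_length (x y : cayley_graph) : set R :=
  [set L | exists n (p : nat -> cayley_graph) (l : nat -> R),
    [/\ p 0%N = x, p n = y,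
        forall i, (i < n)%N -> edge_step (p i) (p i.+1) (l i) &
        L = \sum_(i < n) l i]].

Definition cayley_dist (x y : cayley_graph) : R := inf (path_length x y).

Lemma vertex_subproof (g : G) :
  exists g1 h1, on_edge g1 h1 (fun k => (k == g)%:R).
Proof.
exists g, g; split; first by left.
by exists 0 => [|k]; rewrite ?lexx ?ler01 // subr0 mul1r mul0r addr0.
Qed.

Definition vertex (g : G) : cayley_graph := exist _ _ (vertex_subproof g).

Lemma translate_on_edge (a g h : G) (x : G -> R) :
  on_edge g h x -> on_edge (a * g)%g (a * h)%g (fun k => x (a^-1 * k)%g).
Proof.
move=> [Sgh [t t01 xE]]; split.
  by case: Sgh => [->|Sgh]; [left|right; rewrite invgM -mulgA mulKg].
have aE k b : ((a^-1 * k)%g == b) = (k == (a * b)%g).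
  by apply/eqP/eqP => [<-|->]; rewrite ?mulVKg ?mulKg.
by exists t => // k; rewrite xE !aE.
Qed.

Lemma translate_subproof (a : G) (x : cayley_graph) :
  exists g h, on_edge g h (fun k => sval x (a^-1 * k)%g).
Proof.
by case: x => x /= [g [h xgh]]; exists (a * g)%g, (a * h)%g; exact: translate_on_edge.
Qed.

(* The action of G on the Cayley graph; it sends the vertex h to the vertex ah. *)
Definition translate (a : G) (x : cayley_graph) : cayley_graph :=
  exist _ (fun k => sval x (a^-1 * k)%g) (translate_subproof a x).

End CayleyGraph.
Arguments cayley_graph R {G} S.
Arguments vertex R {G} S g.

Section Boundary.
Context {R : realType}.
Variables (G : groupType) (S : set G).
Local Notation X := (cayley_graph R S).

Definition base_product (x y : X) : R :=
  gromov_product (@cayley_dist R G S) (vertex R S 1%g) x y.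

Definition asymptotic (x y : nat -> X) : Prop :=
  base_product (x p.1) (y p.2) @[p --> (\oo, \oo)] --> +oo.

Definition diverges (x : nat -> X) : Prop := asymptotic x x.

(* The boundary as a set of equivalence classes, each class being a set of
   sequences diverging to infinity. *)
Definition boundary : set (set (nat -> X)) :=
  [set xi | exists2 x, diverges x &
            xi = [set y | diverges y /\ asymptotic x y]].

Definition boundary_product (xi zeta : set (nat -> X)) : \bar R :=
  ereal_sup [set limf_einf (fun p : nat * nat => (base_product (x p.1) (y p.2))%:E)
                           (filter_prod \oo \oo) | x in xi & y in zeta].

Definition visual_rho (eta : R) (xi zeta : set (nat -> X)) : R :=
  fine (expeR (- (eta%:E * boundary_product xi zeta)))%E.

Definition visual_dist (eta : R) (xi zeta : set (nat -> X)) : R :=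
  inf [set r | exists k (z : nat -> set (nat -> X)),
    [/\ forall i, (i <= k.+1)%N -> boundary (z i),
        z 0%N = xi, z k.+1 = zeta &
        r = \sum_(i < k.+1) visual_rho eta (z i) (z i.+1)]].

(* The standing assumptions on the fixed parameter eta of the visual metric; they
   hold for all sufficiently small eta > 0. *)
Definition visual_parameter (delta eta : R) : Prop :=
  let eta' := expR (eta * delta) - 1 in
  [/\ 0 < eta, eta' < 1 / 2,
      compact_metric_space boundary (visual_dist eta) &
      forall xi zeta, boundary xi -> boundary zeta ->
        (1 - 2 * eta') * visual_rho eta xi zeta <= visual_dist eta xi zeta
          <= visual_rho eta xi zeta].

(* The image of an equivalence class of sequences under x_n |-> g x_n. *)
Definition boundary_act (g : G) (xi : set (nat -> X)) : set (nat -> X) :=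
  [set translate g \o x | x in xi].

Definition separated (eta theta : R) (n : nat) (xi zeta : set (nat -> X)) : Prop :=
  exists2 g, word_ball S n g &
    theta <= visual_dist eta (boundary_act g xi) (boundary_act g zeta).

Definition max_separated (eta theta : R) (n : nat) : \bar R :=
  sup_card [set A | A `<=` boundary /\
    forall xi zeta, A xi -> A zeta -> xi <> zeta -> separated eta theta n xi zeta].

Definition boundary_entropy (eta : R) : \bar R :=
  lim (limn_esup (fun n => (n%:R^-1)%:E * lne (max_separated eta theta n))%E
       @[theta --> 0^'+]).

End Boundary.

Section Growth.
Variables (R : realType) (G : groupType) (S : set G).

Definition growth_rate : R :=
  limn (fun n => n%:R^-1 * ln (#|` fset_set (word_ball S n)|)%:R).

Definition rel_separated (n m : nat) (epsilon lambda : R) (x y : G) : Prop :=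
  exists xs ys : nat -> G,
  [/\ forall k, (k <= n)%N ->
        word_sphere S (k * m)%N (xs k) /\ word_sphere S (k * m)%N (ys k),
      [/\ xs 0%N = 1%g, ys 0%N = 1%g, xs n = x & ys n = y],
      forall j, (j < n)%N ->
        (word_dist S (xs j) (xs j.+1))%:R <= m%:R + lambda * epsilon /\
        (word_dist S (ys j) (ys j.+1))%:R <= m%:R + lambda * epsilon &
      exists k, [/\ (k < n)%N, xs k = ys k,
        forall j, (k < j <= n)%N -> xs j <> ys j &
        epsilon <= (word_dist S (xs k.+1) (ys k.+1))%:R]].

Definition max_rel_separated (n m : nat) (epsilon lambda : R) : \bar R :=
  sup_card [set A | A `<=` word_sphere S (m * n)%N /\
    forall x y, A x -> A y -> x <> y -> rel_separated n m epsilon lambda x y].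

Definition rel_growth_at (m : nat) (epsilon lambda : R) : \bar R :=
  limn_esup (fun n => ((m * n)%:R^-1)%:E *
                      lne (max_rel_separated n m epsilon lambda))%E.

Definition rel_growth_rate (mu : R -> R -> R) (tau : R -> R) : \bar R :=
  ereal_sup [set r | exists lambda epsilon m,
    [/\ 0 < lambda < 1, 0 < epsilon /\ tau lambda < epsilon,
        (0 < m)%N /\ mu lambda epsilon < m%:R &
        r = rel_growth_at m epsilon lambda]].

End Growth.

(* Main.v *)
Require Import Defs.
From HB Require Import structures.
From mathcomp Require Import all_boot all_order all_algebra finmap.
From mathcomp Require Import all_classical all_reals all_analysis.
From mathcomp Require Import lra zify.
Import Order.TTheory GRing.Theory Num.Theory.
Import numFieldNormedType.Exports.
Local Open Scope classical_set_scope.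
Local Open Scope ring_scope.

(** Both inequalities compare the number N(n, theta) of pairwise separated
    boundary points with the number of group elements at distance about n from
    the identity.

    Upper bound.  Each boundary point xi has, at every height T, a vertex v of
    length T whose Gromov product with the far terms of a sequence representing
    xi is at least T - delta (shadowed_exists).  If two boundary points admit the
    same v, then their Gromov product is at least T - 2 delta, and an element g of
    length at most n lowers it by at most n.  Hence for T = n + c, with c depending
    only on theta, the images under g stay closer than theta
    (common_shadow_not_separated).  Pairwise separated points therefore have
    distinct vertices, so N(n, theta) is at most the size of the ball of radius
    n + c (max_separated_le), and the growth rate, which is a limit by Fekete's
    lemma, bounds the entropy.

    Lower bound.  The sets counted by the relative growth are contained in spheres,
    so it is enough to bound a sphere of radius n by a constant times N(n, theta)
    for one fixed theta (sphere_le_max_separated).  From every x on the sphere,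
    elements of length |x| + 1, |x| + 2, and so on form a sequence with bounded
    steps; it represents a boundary point whose Gromov product with x is at least
    n - C (escaping_ray).  If x and y on the sphere are far enough apart, then the
    rays issued from them part at height about (x|y), which is at most n, and seen
    from the vertex v at that height on a geodesic from the identity to x the two
    boundary points have a bounded Gromov product (rays_part).  Their images under
    the inverse of v are then at distance at least theta.  Applying this to a
    maximal family of sphere points that are pairwise more than M apart loses only
    the factor given by the size of the ball of radius M, which disappears in the
    exponential rate. *)

(** * Word length and the size of balls *)

Section WordLength.
Context {G : groupType} {S : set G} (genS : symmetric_generating_set S).
Local Notation len := (word_length S).
Local Notation wd := (word_dist S).

Lemma word_lengthP (g : G) :
  expressible S g (len g) /\ forall k, expressible S g k -> (len g <= k)%N.
Proof.
pose least n := expressible S g n /\ forall k, expressible S g k -> (n <= k)%N.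
have [_ _ /(_ g) [w wS wg]] := genS.
have exw : exists n, `[< expressible S g n >] by exists (size w); apply/asboolP; exists w.
case: (ex_minnP exw) => n /asboolP n_expr n_min.
have : least n by split=> // k /asboolP /n_min.
by move=> least_n; exact: (xgetPex 0%N (ex_intro least n least_n)).
Qed.

Lemma word_length_witness (g : G) :
  exists w : seq G, [/\ size w = len g, {in w, forall s, S s} & (\prod_(s <- w) s)%g = g].
Proof. by have [] := word_lengthP g. Qed.

Lemma word_length_prod_le (w : seq G) :
  {in w, forall s, S s} -> (len (\prod_(s <- w) s)%g <= size w)%N.
Proof. by move=> wS; have [_] := word_lengthP (\prod_(s <- w) s)%g; apply; exists w. Qed.

Lemma word_length1 : len 1%g = 0%N.
Proof. by apply/eqP; rewrite -leqn0; have := @word_length_prod_le [::]; rewrite big_nil; apply. Qed.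

Lemma word_length_gen (s : G) : S s -> (len s <= 1)%N.
Proof.
move=> Ss; have := @word_length_prod_le [:: s]; rewrite big_seq1; apply.
by move=> x; rewrite inE => /eqP ->.
Qed.

Lemma word_lengthM (g h : G) : (len (g * h)%g <= len g + len h)%N.
Proof.
have [u [<- uS <-]] := word_length_witness g.
have [v [<- vS <-]] := word_length_witness h.
rewrite -big_cat -size_cat; apply: word_length_prod_le => s.
by rewrite mem_cat => /orP[/uS|/vS].
Qed.

Lemma word_lengthV (g : G) : len g^-1%g = len g.
Proof.
have le_inv h : (len (h^-1)%g <= len h)%N.
  have [_ SV _] := genS; have [w [<- wS <-]] := word_length_witness h.
  elim: w wS => [|s w IHw] wS; first by rewrite big_nil invg1 word_length1.
  rewrite big_cons invgM (leq_trans (word_lengthM _ _)) //= -addn1 leq_add //.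
    by apply: IHw => x xw; apply: wS; rewrite inE xw orbT.
  by apply/word_length_gen/SV/wS; rewrite inE eqxx.
by apply/eqP; rewrite eqn_leq le_inv -{1}(invgK g) le_inv.
Qed.

Lemma word_dist1g (g : G) : wd 1%g g = len g.
Proof. by rewrite /word_dist invg1 mul1g. Qed.

Lemma word_distgg (g : G) : wd g g = 0%N.
Proof. by rewrite /word_dist mulVg word_length1. Qed.

Lemma word_distC (g h : G) : wd g h = wd h g.
Proof. by rewrite /word_dist -word_lengthV invgM invgK. Qed.

Lemma word_dist_triangle (h g k : G) : (wd g k <= wd g h + wd h k)%N.
Proof. by apply: leq_trans (word_lengthM _ _); rewrite mulgA mulgK. Qed.

Lemma word_prefix (g : G) (k : nat) : (k <= len g)%N ->
  exists v, len v = k /\ (wd v g = len g - k)%N.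
Proof.
have [w [wg wS gE]] := word_length_witness g => le_kg.
exists (\prod_(s <- take k w) s)%g.
have prefix_le : (len (\prod_(s <- take k w) s)%g <= k)%N.
  apply: leq_trans (word_length_prod_le _ _) _; first by move=> s /mem_take /wS.
  by rewrite size_take; case: ltnP.
have suffix_le : (wd (\prod_(s <- take k w) s)%g g <= len g - k)%N.
  rewrite /word_dist -{1}gE -{2}(cat_take_drop k w) big_cat mulKg.
  apply: leq_trans (word_length_prod_le _ _) _; first by move=> s /mem_drop /wS.
  by rewrite size_drop wg.
have := word_dist_triangle (\prod_(s <- take k w) s)%g 1%g g.
rewrite !word_dist1g; lia.
Qed.

Hypothesis finS : finite_set S.

Lemma finite_word_ball n : finite_set (word_ball S n).
Proof.
elim: n => [|n IHn].
  apply: (@sub_finite_set _ _ [set 1%g]) => [g|]; last exact: finite_set1.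
  have [w [wg _ gE]] := word_length_witness g.
  rewrite /word_ball /= leqn0 -wg => /nilP w0.
  by rewrite -gE w0 big_nil.
apply: (@sub_finite_set _ _ [set (p.1 * p.2)%g | p in S `*` word_ball S n]).
  have [S1 _ _] := genS.
  move=> g; have [w [wg wS gE]] := word_length_witness g.
  rewrite /word_ball /= -wg; case: w wS gE {wg} => [|s w] wS <- le_w.
    by exists (1, 1)%g; rewrite /= ?mulg1 ?big_nil //; split; rewrite //= word_length1.
  exists (s, \prod_(t <- w) t)%g; rewrite /= ?big_cons //; split=> /=.
    by apply: wS; rewrite inE eqxx.
  apply: leq_trans (word_length_prod_le _ _) _; last exact: le_w.
  by move=> x xw; apply: wS; rewrite inE xw orbT.
exact: finite_image (finite_setX finS IHn).
Qed.

Definition ball_size n := #|` fset_set (word_ball S n)|.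

Lemma mem_ball n g : (g \in fset_set (word_ball S n)) = (len g <= n)%N.
Proof.
rewrite in_fset_set; last exact: finite_word_ball.
by apply/idP/idP => [/set_mem|?]; [|apply/mem_set].
Qed.

Lemma le_ball_size n (s : seq G) :
  uniq s -> {in s, forall g, (len g <= n)%N} -> (size s <= ball_size n)%N.
Proof. by move=> us sn; apply: uniq_leq_size => // g /sn; rewrite mem_ball. Qed.

Lemma ball_size_gt0 n : (0 < ball_size n)%N.
Proof.
apply: (@le_ball_size n [:: 1%g]) => // g; rewrite inE => /eqP ->.
by rewrite word_length1.
Qed.

Lemma ball_size_homo : {homo ball_size : m n / (m <= n)%N}.
Proof.
move=> m n le_mn; apply: uniq_leq_size; first exact: fset_uniq.
by move=> g; rewrite !mem_ball => /leq_trans; apply.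
Qed.

(** A word of length at most m + n splits into words of length at most m and n. *)
Lemma ball_sizeD m n : (ball_size (m + n) <= ball_size m * ball_size n)%N.
Proof.
rewrite /ball_size.
have <- := size_allpairs (fun g h : G => (g * h)%g)
  (fset_set (word_ball S m)) (fset_set (word_ball S n)).
apply: uniq_leq_size => [|g]; first exact: fset_uniq.
rewrite mem_ball => le_g.
have [v [vE wdE]] := word_prefix _ _ (geq_minr m (len g)).
rewrite -(mulVKg v g); apply: allpairs_f; rewrite mem_ball.
  by rewrite vE geq_minl.
by move: wdE; rewrite /word_dist => ->; lia.
Qed.

End WordLength.

(** * The path metric of the Cayley graph *)

Section CayleyMetric.
Context {R : realType} {G : groupType} {S : set G} (genS : symmetric_generating_set S).
Local Notation X := (cayley_graph R S).
Local Notation d := (@cayley_dist R G S).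
Local Notation V := (vertex R S).
Local Notation wd := (word_dist S).

Lemma path_length_refl (x : X) : path_length x x 0.
Proof. by exists 0%N, (fun=> x), (fun=> 0); split=> //; rewrite big_ord0. Qed.

Lemma path_length_cons (x y z : X) (l L : R) :
  edge_step x y l -> path_length y z L -> path_length x z (l + L).
Proof.
move=> xy [n [p [ls [p0 pn pE ->]]]].
exists n.+1, (fun i => if i is j.+1 then p j else x), (fun i => if i is j.+1 then ls j else l).
split=> //; last by rewrite big_ord_recl.
by case=> [|i]; rewrite ?p0 // ltnS => /pE.
Qed.

Lemma path_length_ind (P : X -> X -> R -> Prop) :
  (forall x, P x x 0) ->
  (forall x y z l L, edge_step x y l -> path_length y z L -> P y z L -> P x z (l + L)) ->
  forall x y L, path_length x y L -> P x y L.
Proof.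
move=> P0 Pcons x y L [n [p [ls [<- <- pE ->]]]] {x y L}.
elim: n p ls pE => [|n IHn] p ls pE; first by rewrite big_ord0.
rewrite big_ord_recl; apply: (Pcons _ (p 1%N)); first exact: pE.
  exists n, (p \o succn), (ls \o succn); split=> //.
  by move=> i lt_in; exact: pE.
by apply: (IHn (p \o succn) (ls \o succn)) => i lt_in; exact: pE.
Qed.

Lemma path_length_cat (y x z : X) (L1 L2 : R) :
  path_length x y L1 -> path_length y z L2 -> path_length x z (L1 + L2).
Proof.
move=> pxy; move: x y L1 pxy z L2.
apply: path_length_ind => [x z L2|x u y l L1 xu _ IH z L2 /IH yz].
  by rewrite add0r.
by rewrite -addrA; exact: path_length_cons xu yz.
Qed.

Lemma edge_stepC (x y : X) (l : R) : edge_step x y l -> edge_step y x l.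
Proof. by move=> [g [h [xgh ygh ->]]]; exists g, h; split=> //; rewrite distrC. Qed.

Lemma path_lengthC (x y : X) (L : R) : path_length x y L -> path_length y x L.
Proof.
move: x y L; apply: path_length_ind => [x|x y z l L xy _ zy].
  exact: path_length_refl.
rewrite addrC; apply: path_length_cat zy _.
rewrite -[l]addr0; apply: path_length_cons (path_length_refl _).
exact: edge_stepC.
Qed.

Lemma path_length_ge0 (x y : X) (L : R) : path_length x y L -> 0 <= L.
Proof.
move: x y L; apply: path_length_ind => [//|x y z l L [g [h [_ _ ->]]] _ L0].
by rewrite addr_ge0.
Qed.

Lemma on_edge_vertexl (g h : G) (x : G -> R) : on_edge S g h x -> on_edge S g h (sval (V g)).
Proof.
move=> [gh _]; split=> //; exists 0 => [|k /=]; first by rewrite lexx ler01.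
by rewrite subr0 mul1r mul0r addr0.
Qed.

Lemma on_edge_vertexr (g h : G) (x : G -> R) : on_edge S g h x -> on_edge S g h (sval (V h)).
Proof.
move=> [gh _]; split=> //; exists 1 => [|k /=]; first by rewrite lexx ler01.
by rewrite subrr mul1r mul0r add0r.
Qed.

Lemma path_to_vertex (x : X) : exists g L, path_length x (V g) L /\ L <= 1.
Proof.
have [g [h xgh]] := svalP x; exists g, (`|sval x g - sval (V g) g| + 0); split.
  apply: path_length_cons (path_length_refl _); exists g, h; split=> //.
  exact: on_edge_vertexl xgh.
have [_ [t /andP[t0 t1] ->]] := xgh.
by rewrite /= eqxx addr0 ler_norml; case: (g == h) => /=; lra.
Qed.

Lemma path_to_neighbour (g s : G) : S s ->
  exists L, path_length (V g) (V (g * s)%g) L /\ L <= 1.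
Proof.
move=> Ss; exists (`|sval (V g) g - sval (V (g * s)%g) g| + 0); split.
  have gs : on_edge S g (g * s)%g (sval (V g)).
    split; first by right; rewrite mulKg.
    by exists 0 => [|k /=]; rewrite ?lexx ?ler01 // subr0 mul1r mul0r addr0.
  apply: path_length_cons (path_length_refl _); exists g, (g * s)%g; split=> //.
  exact: on_edge_vertexr gs.
by rewrite /= eqxx addr0 ler_norml; case: eqP => /= _; lra.
Qed.

Lemma path_between_vertices (g h : G) :
  exists L, path_length (V g) (V h) L /\ L <= (wd g h)%:R.
Proof.
rewrite /word_dist; have [w [<- wS]] := word_length_witness genS (g^-1 * h)%g.
move=> /(congr1 (fun k => g * k)%g); rewrite mulVKg => <-.
elim: w g wS => [|s w IHw] g wS.
  by exists 0; rewrite big_nil mulg1; split=> //; exact: path_length_refl.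
have [|L1 [p1 L1le]] := @path_to_neighbour g s; first by apply: wS; rewrite inE eqxx.
have [|L2 [p2 L2le]] := IHw (g * s)%g.
  by move=> x xw; apply: wS; rewrite inE xw orbT.
exists (L1 + L2); split; first by rewrite big_cons mulgA; exact: path_length_cat p1 p2.
by rewrite /= -add1n natrD lerD.
Qed.

Lemma path_length_nonempty (x y : X) : path_length x y !=set0.
Proof.
have [g [L1 [p1 _]]] := path_to_vertex x; have [h [L2 [p2 _]]] := path_to_vertex y.
have [L [p _]] := path_between_vertices g h.
exists (L1 + (L + L2)); apply: path_length_cat p1 _.
by apply: path_length_cat p _; exact: path_lengthC.
Qed.

Lemma cayley_dist_le (x y : X) (L : R) : path_length x y L -> d x y <= L.
Proof. by move=> xy; apply: ge_inf => //; exists 0 => l; exact: path_length_ge0. Qed.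

Lemma le_cayley_dist (x y : X) (r : R) :
  (forall L, path_length x y L -> r <= L) -> r <= d x y.
Proof. by move=> rL; apply: lb_le_inf => //; exact: path_length_nonempty. Qed.

Lemma cayley_distC (x y : X) : d x y = d y x.
Proof.
by apply/eqP; rewrite eq_le; apply/andP; split; apply: le_cayley_dist => L /path_lengthC;
  exact: cayley_dist_le.
Qed.

Lemma cayley_dist_triangle (y x z : X) : d x z <= d x y + d y z.
Proof.
rewrite -lerBlDr; apply: le_cayley_dist => L1 xy.
rewrite lerBlDr -lerBlDl; apply: le_cayley_dist => L2 yz.
by rewrite lerBlDl; apply/cayley_dist_le/path_length_cat/yz.
Qed.

Lemma near_vertex (x : X) : exists g, d x (V g) <= 1.
Proof.
by have [g [L [p L1]]] := path_to_vertex x; exists g; exact: le_trans (cayley_dist_le _ _ _ p) L1.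
Qed.

(** The affine extension of f to the edges is well defined: a point may be
    written with several pairs of endpoints, but each expression equals the sum
    of f weighted by the barycentric coordinates. *)
Lemma affine_extension (f : G -> R) (x : G -> R) (g h g' h' : G) (t t' : R) :
  (forall k, x k = (1 - t) * (k == g)%:R + t * (k == h)%:R) ->
  (forall k, x k = (1 - t') * (k == g')%:R + t' * (k == h')%:R) ->
  (1 - t) * f g + t * f h = (1 - t') * f g' + t' * f h'.
Proof.
pose s := undup [:: g; h; g'; h'].
have pick a : a \in s -> \sum_(k <- s) (k == a)%:R * f k = f a.
  move=> sa; rewrite (bigD1_seq a) ?undup_uniq //= eqxx mul1r big1 ?addr0 // => k.
  by move=> /negbTE ->; rewrite mul0r.
have mem_s k : k \in [:: g; h; g'; h'] -> k \in s by rewrite mem_undup.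
have weighted a b u : a \in s -> b \in s ->
    (forall k, x k = (1 - u) * (k == a)%:R + u * (k == b)%:R) ->
    \sum_(k <- s) x k * f k = (1 - u) * f a + u * f b.
  move=> sa sb xE; rewrite -(pick a sa) -(pick b sb) !mulr_sumr -big_split /=.
  by apply: eq_bigr => k _; rewrite xE mulrDl !mulrA.
move=> xE xE'; rewrite -(weighted g h t _ _ xE); first apply: weighted.
all: by rewrite // mem_s // !inE eqxx ?orbT.
Qed.

(** An edge step moves along a single edge, where the extension is affine with
    slope at most 1; applied to f = word_dist g, this bounds the length of every
    path between two vertices from below. *)
Lemma affine_extension_lipschitz (f : G -> R) (x y : X) (L : R) :
  (forall g h, S (g^-1 * h)%g -> `|f g - f h| <= 1) -> path_length x y L ->
  forall g h t g' h' t',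
  (forall k, sval x k = (1 - t) * (k == g)%:R + t * (k == h)%:R) ->
  (forall k, sval y k = (1 - t') * (k == g')%:R + t' * (k == h')%:R) ->
  ((1 - t') * f g' + t' * f h') - ((1 - t) * f g + t * f h) <= L.
Proof.
move=> f_lip; move: x y L.
apply: path_length_ind => [x|x y z l L xy _ IH] g h t g' h' t' xE.
  by move=> /(affine_extension f _ _ _ _ _ _ _ xE) ->; rewrite subrr.
move=> /IH {}IH.
have [a [b [[Sab [u u01 xE']] [_ [v v01 yE]] ->]]] := xy.
have {}IH := IH _ _ _ yE.
rewrite (affine_extension f _ _ _ _ _ _ _ xE xE').
have : ((1 - v) * f a + v * f b) - ((1 - u) * f a + u * f b) <= `|sval x a - sval y a|.
  rewrite xE' yE eqxx.
  case: Sab => [<-|/f_lip].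
    by rewrite eqxx; apply: le_trans (normr_ge0 _); nra.
  case: (eqVneq a b) => [<- _|_ lip1].
    by apply: le_trans (normr_ge0 _); nra.
  rewrite /= !mulr1 !mulr0 !addr0.
  have -> : 1 - u - (1 - v) = v - u by lra.
  apply: le_trans (ler_norm _) _.
  have -> : (1 - v) * f a + v * f b - ((1 - u) * f a + u * f b) = (v - u) * (f b - f a).
    by rewrite mulrBl !mulrBr !mulrBl !mul1r; lra.
  by rewrite normrM ler_piMr // distrC.
by move: IH; lra.
Qed.

Lemma cayley_dist_vertex (g h : G) : d (V g) (V h) = (wd g h)%:R.
Proof.
apply/eqP; rewrite eq_le; apply/andP; split.
  have [L [p Lle]] := path_between_vertices g h.
  exact: le_trans (cayley_dist_le _ _ _ p) Lle.
apply: le_cayley_dist => L p.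
have vE a k : sval (V a) k = (1 - 0) * (k == a)%:R + 0 * (k == a)%:R :> R.
  by rewrite subr0 mul1r mul0r addr0.
have lip1 a b : S (a^-1 * b)%g -> `|(wd g a)%:R - (wd g b)%:R| <= 1 :> R.
  move=> /(word_length_gen genS) ab1.
  have := word_dist_triangle genS a g b; have := word_dist_triangle genS b g a.
  rewrite (word_distC genS b a) -[wd a b]/(word_length S _).
  move: ab1; rewrite ler_norml -!(ler_nat R) !natrD; lra.
have := affine_extension_lipschitz (fun a => (wd g a)%:R) _ _ _ lip1 p _ _ _ _ _ _ (vE g) (vE h).
by rewrite (word_distgg genS); lra.
Qed.

Lemma edge_step_translate (a : G) (x y : X) (l : R) :
  edge_step x y l -> edge_step (translate a x) (translate a y) l.
Proof.
move=> [g [h [xgh ygh ->]]]; exists (a * g)%g, (a * h)%g; split.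
- exact: translate_on_edge.
- exact: translate_on_edge.
- by rewrite /= mulKg.
Qed.

Lemma cayley_graph_inj (x y : X) : sval x = sval y -> x = y.
Proof. by case: x y => [x xP] [y yP] /= xy; apply: eq_exist. Qed.

Lemma translateK (a : G) : cancel (@translate R G S a) (translate a^-1).
Proof.
move=> x; apply: cayley_graph_inj; apply/funext => k /=.
by rewrite invgK mulKg.
Qed.

Lemma translateVK (a : G) : cancel (@translate R G S a^-1) (translate a).
Proof. by move=> x; rewrite -{1}(invgK a) translateK. Qed.

Lemma translate_vertex (a g : G) : translate a (V g) = V (a * g)%g.
Proof.
apply: cayley_graph_inj; apply/funext => k /=; congr (_%:R); congr nat_of_bool.
by apply/eqP/eqP => [<-|->]; rewrite ?mulVKg ?mulKg.
Qed.

Lemma cayley_dist_translate (a : G) (x y : X) : d (translate a x) (translate a y) = d x y.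
Proof.
have path_translate (b : G) (u v : X) (L : R) :
    path_length u v L -> path_length (translate b u) (translate b v) L.
  move: u v L.
  apply: path_length_ind => [u|u v w l L uv _ vw].
    exact: path_length_refl.
  by apply: path_length_cons vw; exact: edge_step_translate.
apply/eqP; rewrite eq_le; apply/andP; split; apply: le_cayley_dist => L.
  by move=> /path_translate p; exact: cayley_dist_le.
by move=> /(path_translate a^-1%g); rewrite !translateK => p; exact: cayley_dist_le p.
Qed.

End CayleyMetric.

(** * Gromov products and the boundary *)

Section DoubleSequences.
Context {R : realType}.

Lemma near_oo2P (P : nat * nat -> Prop) :
  (\forall p \near (\oo, \oo), P p) <->
  exists N, forall i j, (N <= i)%N -> (N <= j)%N -> P (i, j).
Proof.
split=> [[[A B] /= [[N1 _ A1] [N2 _ B2]] AB]|[N PN]].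
  exists (maxn N1 N2) => i j; rewrite !geq_max => /andP[i1 _] /andP[_ j2].
  by apply: (AB (i, j)); split; [apply: A1|apply: B2].
exists ([set i | (N <= i)%N], [set i | (N <= i)%N]); first by split; exists N.
by move=> [i j] [Ni Nj]; exact: PN.
Qed.

Lemma le_liminf2 (f : nat * nat -> \bar R) (r : \bar R) :
  (exists N, forall i j, (N <= i)%N -> (N <= j)%N -> (r <= f (i, j))%E) ->
  (r <= limf_einf f (filter_prod \oo \oo))%E.
Proof.
move=> /(near_oo2P (fun p => (r <= f p)%E)) near_r; rewrite limf_einfE.
apply: le_trans (ereal_sup_ubound _); last first.
  by exists [set p | (r <= f p)%E]; [exact: near_r|].
by apply: le_ereal_inf_tmp => _ [p rp <-].
Qed.

Lemma liminf2_le (f : nat * nat -> \bar R) (r : \bar R) :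
  (exists N, forall i j, (N <= i)%N -> (N <= j)%N -> (f (i, j) <= r)%E) ->
  (limf_einf f (filter_prod \oo \oo) <= r)%E.
Proof.
move=> [N fr]; rewrite limf_einfE; apply: ge_ereal_sup => _ [A /near_oo2P[M AM] <-].
apply: le_trans (fr (maxn N M) (maxn N M) _ _); rewrite ?leq_maxl //.
apply: ereal_inf_lbound; exists (maxn N M, maxn N M) => //.
by apply: AM; rewrite leq_maxr.
Qed.

End DoubleSequences.

Section Boundary.
Context {R : realType} {G : groupType} {S : set G} (genS : symmetric_generating_set S).
Context (delta : R) (delta_ge0 : 0 <= delta).
Context (hypS : hyperbolic (@cayley_dist R G S) delta).
Local Notation X := (cayley_graph R S).
Local Notation d := (@cayley_dist R G S).
Local Notation V := (vertex R S).
Local Notation wd := (word_dist S).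
Local Notation len := (word_length S).
Local Notation gp := (@base_product R G S).

Lemma base_productC (x y : X) : gp x y = gp y x.
Proof. by rewrite /base_product /gromov_product (cayley_distC genS x y) [X in X - _]addrC. Qed.

Lemma cayley_distE (x y : X) : d x y = d (V 1%g) x + d (V 1%g) y - 2 * gp x y.
Proof. by rewrite /base_product /gromov_product; lra. Qed.

Lemma base_product_ge0 (x y : X) : 0 <= gp x y.
Proof.
rewrite /base_product /gromov_product.
have := cayley_dist_triangle genS (V 1%g) x y.
by rewrite (cayley_distC genS x (V 1%g)); lra.
Qed.

Lemma base_product_le (x y : X) : gp x y <= d (V 1%g) x.
Proof.
rewrite /base_product /gromov_product.
by have := cayley_dist_triangle genS x (V 1%g) y; lra.
Qed.

Lemma base_product_lipschitz (x' x y : X) : gp x y <= gp x' y + d x x'.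
Proof.
rewrite /base_product /gromov_product.
have := cayley_dist_triangle genS x' (V 1%g) x; have := cayley_dist_triangle genS x x' y.
by rewrite (cayley_distC genS x' x); lra.
Qed.

Lemma base_product_hyperbolic (y x z : X) :
  gp x y - delta <= gp x z \/ gp y z - delta <= gp x z.
Proof.
have := hypS (V 1%g) x y z.
by rewrite minEle; case: ifP => _; [left|right].
Qed.

Lemma dist_base_vertex (g : G) : d (V 1%g) (V g) = (len g)%:R.
Proof. by rewrite (cayley_dist_vertex genS) word_dist1g. Qed.

Lemma base_product_vertex (g h : G) :
  gp (V g) (V h) = ((len g)%:R + (len h)%:R - (wd g h)%:R) / 2.
Proof. by rewrite /base_product /gromov_product !dist_base_vertex (cayley_dist_vertex genS). Qed.

Lemma base_product_translate (g : G) (x y : X) :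
  gp (translate g x) (translate g y) = gromov_product d (V g^-1%g) x y.
Proof.
have e_g : V 1%g = translate g (V g^-1%g) by rewrite translate_vertex mulgV.
by rewrite /base_product e_g /gromov_product !(cayley_dist_translate genS).
Qed.

(** Translating by g amounts to moving the base point by the length of g, which
    changes a Gromov product by at most that length. *)
Lemma base_product_translate_ge (g : G) (x y : X) :
  gp x y - (len g)%:R <= gp (translate g x) (translate g y).
Proof.
rewrite base_product_translate /base_product /gromov_product.
have := cayley_dist_triangle genS (V g^-1%g) (V 1%g) x.
have := cayley_dist_triangle genS (V g^-1%g) (V 1%g) y.
by rewrite dist_base_vertex (word_lengthV genS); lra.
Qed.

Lemma asymptoticP (x y : nat -> X) : asymptotic x y <->
  forall r : R, exists N, forall i j, (N <= i)%N -> (N <= j)%N -> r <= gp (x i) (y j).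
Proof.
split=> [/cvgryPge xy r|xy].
  by apply/(near_oo2P (fun p => r <= gp (x p.1) (y p.2))); exact: xy.
by apply/cvgryPge => r; apply/(near_oo2P (fun p => r <= gp (x p.1) (y p.2))); exact: xy.
Qed.

Lemma asymptoticC (x y : nat -> X) : asymptotic x y -> asymptotic y x.
Proof.
move=> /asymptoticP xy; apply/asymptoticP => r; have [N rN] := xy r.
by exists N => i j Ni Nj; rewrite base_productC; exact: rN.
Qed.

Lemma asymptotic_trans (y x z : nat -> X) : asymptotic x y -> asymptotic y z -> asymptotic x z.
Proof.
move=> /asymptoticP xy /asymptoticP yz; apply/asymptoticP => r.
have [N1 xyN] := xy (r + delta); have [N2 yzN] := yz (r + delta).
exists (maxn N1 N2) => i j; rewrite !geq_max => /andP[i1 i2] /andP[j1 j2].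
have := xyN i (maxn N1 N2) i1 (leq_maxl _ _); have := yzN (maxn N1 N2) j (leq_maxr _ _) j2.
by have [] := base_product_hyperbolic (y (maxn N1 N2)) (x i) (z j); lra.
Qed.

Lemma asymptotic_translate (g : G) (x y : nat -> X) :
  asymptotic x y -> asymptotic (translate g \o x) (translate g \o y).
Proof.
move=> /asymptoticP xy; apply/asymptoticP => r.
have [N xyN] := xy (r + (len g)%:R); exists N => i j Ni Nj.
by have := base_product_translate_ge g (x i) (y j); have := xyN i j Ni Nj; rewrite /=; lra.
Qed.

Definition boundary_point (x : nat -> X) : set (nat -> X) :=
  [set y | diverges y /\ asymptotic x y].

Lemma boundary_point_boundary (x : nat -> X) : diverges x -> boundary (boundary_point x).
Proof. by move=> x_div; exists x. Qed.

Lemma boundary_asymptotic (xi : set (nat -> X)) (x y : nat -> X) :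
  boundary xi -> xi x -> xi y -> asymptotic x y.
Proof.
by move=> [z _ ->] [_ /asymptoticC xz] [_ zy]; exact: asymptotic_trans xz zy.
Qed.

Lemma boundary_nonempty (xi : set (nat -> X)) : boundary xi -> exists2 x, xi x & diverges x.
Proof. by move=> [x x_div ->]; exists x. Qed.

Lemma boundary_act_boundary (g : G) (xi : set (nat -> X)) :
  boundary xi -> boundary (boundary_act g xi).
Proof.
move=> [x x_div ->]; exists (translate g \o x); first exact: asymptotic_translate.
apply/seteqP; split=> [_ [y [y_div xy] <-]|y [y_div xy]].
  by split; exact: asymptotic_translate.
have gK (u : nat -> X) : translate g^-1%g \o (translate g \o u) = u.
  by apply/funext => i; rewrite /= translateK.
exists (translate g^-1%g \o y); last by apply/funext => i; rewrite /= translateVK.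
split; first exact: asymptotic_translate.
by have := asymptotic_translate g^-1%g _ _ xy; rewrite gK.
Qed.

Lemma le_boundary_product (xi zeta : set (nat -> X)) (x y : nat -> X) (r : R) :
  xi x -> zeta y ->
  (exists N, forall i j, (N <= i)%N -> (N <= j)%N -> r <= gp (x i) (y j)) ->
  (r%:E <= boundary_product xi zeta)%E.
Proof.
move=> xix zetay [N rN]; apply: le_trans (ereal_sup_ubound _); last first.
  by exists x => //; exists y.
by apply: le_liminf2; exists N => i j Ni Nj; rewrite lee_fin; exact: rN.
Qed.

(** The supremum over all representatives is controlled by a single pair, because
    any other pair is asymptotic to it: two uses of hyperbolicity cost 2 * delta. *)
Lemma boundary_product_le (xi zeta : set (nat -> X)) (x y : nat -> X) (r : R) :
  boundary xi -> boundary zeta -> xi x -> zeta y ->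
  (forall i j, gp (x i) (y j) <= r) ->
  (boundary_product xi zeta <= (r + 2 * delta)%:E)%E.
Proof.
move=> bxi bzeta xix zetay xyr; apply: ge_ereal_sup => _ [a xia [b zetab <-]].
have /asymptoticP xa := boundary_asymptotic xi x a bxi xix xia.
have /asymptoticP yb := boundary_asymptotic zeta b y bzeta zetab zetay.
have [N1 xaN] := xa (r + 2 * delta + 1); have [N2 ybN] := yb (r + 2 * delta + 1).
apply: liminf2_le; exists (maxn N1 N2) => i j.
rewrite !geq_max => /andP[i1 i2] /andP[j1 j2]; rewrite lee_fin /=.
have := xyr N1 N2; have := xaN N1 i (leqnn _) i1; have := ybN j N2 j2 (leqnn _).
have [] := base_product_hyperbolic (a i) (x N1) (y N2);
have [] := base_product_hyperbolic (b j) (a i) (y N2); move: delta_ge0; lra.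
Qed.

Lemma visual_rho_le (eta r : R) (xi zeta : set (nat -> X)) : 0 < eta ->
  (r%:E <= boundary_product xi zeta)%E -> visual_rho eta xi zeta <= expR (- (eta * r)).
Proof.
rewrite /visual_rho => eta0; case: (boundary_product xi zeta) => [s||] //=.
  by rewrite lee_fin => rs; rewrite ler_expR lerN2 ler_pM2l.
by rewrite gt0_muley ?lte_fin //= => _; exact: expR_ge0.
Qed.

Lemma le_visual_rho (eta r : R) (xi zeta : set (nat -> X)) : 0 < eta ->
  (0 <= boundary_product xi zeta)%E -> (boundary_product xi zeta <= r%:E)%E ->
  expR (- (eta * r)) <= visual_rho eta xi zeta.
Proof.
rewrite /visual_rho => eta0; case: (boundary_product xi zeta) => [s||] //= _.
by rewrite lee_fin => rs; rewrite ler_expR lerN2 ler_pM2l.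
Qed.

(** The vertex v is, up to delta, at height T on a geodesic from the identity to
    the boundary point xi. *)
Definition shadowed (T : nat) (xi : set (nat -> X)) (v : G) : Prop :=
  len v = T /\ exists2 x, xi x &
    exists N, forall i, (N <= i)%N -> T%:R - delta <= gp (V v) (x i).

Lemma shadowed_exists (T : nat) (xi : set (nat -> X)) :
  boundary xi -> exists v, shadowed T xi v.
Proof.
move=> /boundary_nonempty[x xix /asymptoticP/(_ (T%:R + 1))[N xxN]].
have [h xh] := near_vertex (x N).
have hx i : (N <= i)%N -> T%:R <= gp (V h) (x i).
  move=> Ni; have := xxN N i (leqnn _) Ni.
  by have := base_product_lipschitz (V h) (x N) (x i); lra.
have le_Th : (T <= len h)%N.
  rewrite -(ler_nat R) -dist_base_vertex; apply: le_trans (hx N (leqnn _)) _.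
  exact: base_product_le.
have [v [vT vh]] := word_prefix genS h T le_Th.
exists v; split=> //; exists x => //; exists N => i Ni.
have vhT : gp (V v) (V h) = T%:R.
  by rewrite base_product_vertex vh vT natrB //; lra.
have := hx i Ni; have [] := base_product_hyperbolic (V h) (V v) (x i); move: vhT; lra.
Qed.

Context (eta : R) (eta_visual : visual_parameter S delta eta).

(** A common vertex at height n + c gives a Gromov product of at least
    n + c - 2 * delta; moving the base point by n leaves c - 2 * delta, and c is
    chosen so that exp (- eta * (c - 2 * delta)) < theta. *)
Lemma common_shadow_not_separated (theta : R) : 0 < theta ->
  exists c : nat, forall n xi zeta v, boundary xi -> boundary zeta ->
    shadowed (n + c) xi v -> shadowed (n + c) zeta v -> ~ Defs.separated eta theta n xi zeta.
Proof.
move=> theta0; have [eta0 _ _ visual_bounds] := eta_visual.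
exists (Num.bound `|2 * delta - ln theta / eta|) => n xi zeta v bxi bzeta.
set c := Num.bound _; have c_gt : 2 * delta - ln theta / eta < c%:R.
  exact: le_lt_trans (ler_norm _) (archi_boundP (normr_ge0 _)).
move=> [_ [x xix [N1 vx]]] [_ [y zetay [N2 vy]]] [g gn].
have bgxi := boundary_act_boundary g xi bxi; have bgzeta := boundary_act_boundary g zeta bzeta.
have [_ le_rho] := andP (visual_bounds _ _ bgxi bgzeta).
apply/negP; rewrite -ltNge; apply: le_lt_trans le_rho _.
apply: le_lt_trans (_ : expR (- (eta * (c%:R - 2 * delta))) < _).
  apply: visual_rho_le => //.
  apply: (le_boundary_product _ _ (translate g \o x) (translate g \o y)).
  - by exists x.
  - by exists y.
  exists (maxn N1 N2) => i j; rewrite !geq_max => /andP[i1 i2] /andP[j1 j2] /=.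
  have := base_product_translate_ge g (x i) (y j).
  have := vx i i1; have := vy j j2; rewrite natrD (base_productC (V v) (x i)).
  have : (len g)%:R <= n%:R :> R by rewrite ler_nat.
  have [] := base_product_hyperbolic (V v) (x i) (y j); lra.
rewrite -ltr_ln ?posrE ?expR_gt0 // expRK ltrNl -ltr_pdivrMl // mulrC.
by rewrite mulNr; lra.
Qed.

Lemma not_separated_self (theta : R) (n : nat) (xi : set (nat -> X)) :
  0 < theta -> boundary xi -> ~ Defs.separated eta theta n xi xi.
Proof.
move=> theta0 bxi; have [c not_sep] := common_shadow_not_separated theta theta0.
by have [v xiv] := shadowed_exists (n + c) xi bxi; exact: (not_sep n xi xi v).
Qed.

Lemma max_separated_le (theta : R) : finite_set S -> 0 < theta ->
  exists c : nat, forall n,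
    (max_separated S eta theta n <= (@ball_size G S (n + c))%:R%:E)%E.
Proof.
move=> finS theta0; have [c not_sep] := common_shadow_not_separated theta theta0.
exists c => n; apply: ge_ereal_sup => _ [k [A [Aboundary Asep] Ak] <-].
rewrite lee_fin ler_nat.
have [f [fA f_inj _]] : exists f : nat -> set (nat -> X), set_bij `I_k A f.
  by apply/card_set_bijP; rewrite card_eq_sym.
have /choice[v vP] : forall i, exists v, (i < k)%N -> shadowed (n + c) (f i) v.
  move=> i; case: (ltnP i k) => [ik|]; last by exists 1%g.
  by have [v iv] := shadowed_exists (n + c) (f i) (Aboundary _ (fA _ ik)); exists v.
have v_inj : {in iota 0 k &, injective v}.
  move=> i j; rewrite !mem_iota !add0n /= => ik jk vij.
  apply: contrapT => /eqP ij.
  apply: (not_sep n (f i) (f j) (v i)); [exact/Aboundary/fA|exact/Aboundary/fA| | |].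
  - exact: vP.
  - by rewrite vij; exact: vP.
  apply: Asep; [exact: fA|exact: fA|].
  by move=> /f_inj ijE; move: ij; rewrite ijE ?eqxx ?inE.
have := @le_ball_size G S genS finS (n + c) [seq v i | i <- iota 0 k].
rewrite size_map size_iota; apply; first by rewrite map_inj_in_uniq ?iota_uniq.
move=> _ /mapP[i + ->]; rewrite mem_iota => /vP[-> _] //.
Qed.

End Boundary.

(** * Rays leaving a sphere *)

(** The greedy choice of a maximal subset whose elements are pairwise unrelated
    by r, where r x y stands for: x and y are close. *)
Lemma exists_separated_net (T : eqType) (r : rel T) (s : seq T) :
  reflexive r -> symmetric r ->
  exists t : seq T, [/\ {subset t <= s}, uniq t,
    {in t &, forall x y, x != y -> ~~ r x y} &
    {in s, forall x, exists2 y, y \in t & r y x}].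
Proof.
move=> r_refl r_sym; elim: s => [|a s [t [ts ut t_sep s_near]]].
  by exists [::]; split.
case: (boolP (has (r^~ a) t)) => [/hasP[b bt ba]|/hasPn a_far].
  exists t; split=> // [x /ts|x]; first by rewrite inE => ->; rewrite orbT.
  by rewrite inE => /predU1P[->|/s_near //]; exists b.
exists (a :: t); split.
- by move=> x; rewrite !inE => /predU1P[->|/ts ->]; rewrite ?eqxx ?orbT.
- by rewrite /= ut andbT; apply/negP => /a_far; rewrite r_refl.
- move=> x y; rewrite !inE => /predU1P[->|xt] /predU1P[->|yt]; first by rewrite eqxx.
  + by rewrite r_sym => _; exact: a_far.
  + by move=> _; exact: a_far.
  + exact: t_sep.
- move=> x; rewrite inE => /predU1P[->|/s_near[y yt yx]]; first by exists a; rewrite ?inE ?eqxx.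
  by exists y => //; rewrite inE yt orbT.
Qed.

Section LowerBound.
Context {R : realType} {G : groupType} {S : set G} (genS : symmetric_generating_set S).
Context (delta : R) (delta_ge0 : 0 <= delta).
Context (hypS : hyperbolic (@cayley_dist R G S) delta).
Context (c0 : R) (c0_gt1 : 1 < c0)
  (c0_extends : forall g : G, exists g' : G,
     (word_dist S g g')%:R <= c0 /\ word_length S g' = (word_length S g + 1)%N).
Local Notation X := (cayley_graph R S).
Local Notation d := (@cayley_dist R G S).
Local Notation V := (vertex R S).
Local Notation wd := (word_dist S).
Local Notation len := (word_length S).
Local Notation gp := (@base_product R G S).

Lemma escaping_sequence : exists next : G -> nat -> G, forall g,
  [/\ next g 0%N = g, forall i, len (next g i) = (len g + i)%N &
      forall i j, (wd (next g i) (next g (i + j)%N))%:R <= j%:R * c0].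
Proof.
have [f f_ext] := choice c0_extends.
have len_next g i : len (iter i f g) = (len g + i)%N.
  by elim: i => [|i IHi]; rewrite ?addn0 //= (f_ext _).2 IHi addn1 addnS.
exists (fun g i => iter i f g) => g; split=> // i j.
elim: j => [|j IHj]; first by rewrite addn0 word_distgg // mul0r.
have := word_dist_triangle genS (iter (i + j) f g) (iter i f g) (iter (i + j.+1) f g).
rewrite -(ler_nat R) natrD => /le_trans; apply.
rewrite -addn1 natrD mulrDl mul1r; apply: lerD IHj _.
by rewrite addn1 addnS; exact: (f_ext _).1.
Qed.

(** Taking steps of the escaping sequence p at a time, with p at least delta,
    the progress made at each step outweighs the loss of delta in the
    hyperbolicity inequality, so that the losses do not accumulate. *)
Lemma escaping_ray : exists C : R, 0 <= C /\ forall g, exists z : nat -> G,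
  z 0%N = g /\
  forall i j, (i <= j)%N -> (len g)%:R + i%:R - C <= gp (V (z i)) (V (z j)).
Proof.
have [next next_ext] := escaping_sequence.
have [p p_gt0 p_delta] : exists2 p : nat, (0 < p)%N & delta <= p%:R.
  exists (Num.bound delta).+1 => //.
  by apply: ltW; apply: lt_trans (archi_boundP delta_ge0) _; rewrite ltr_nat.
have delta0 := delta_ge0.
pose C : R := (c0 - 1) * p%:R / 2.
have C0 : 0 <= C by rewrite divr_ge0 // mulr_ge0 // subr_ge0 ltW.
exists (C + delta); split; first by rewrite addr_ge0.
move=> g; exists (fun i => next g (i * p)%N).
have [next0 len_next wd_next] := next_ext g; split=> //.
have step i : (len g)%:R + (i * p)%:R - C
    <= gp (V (next g (i * p)%N)) (V (next g (i.+1 * p)%N)).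
  rewrite (base_product_vertex genS) !len_next.
  have := wd_next (i * p)%N p; rewrite mulSnr !natrD /C; lra.
have chain j : forall i, (len g)%:R + (i * p)%:R - (C + delta)
    <= gp (V (next g (i * p)%N)) (V (next g ((i + j) * p)%N)).
  elim: j => [|j IHj] i.
    by rewrite addn0 (base_product_vertex genS) len_next word_distgg // natrD; lra.
  have := IHj i.+1; rewrite addSnnS; have := step i.
  have : (i.+1 * p)%:R = (i * p)%:R + p%:R :> R by rewrite mulSnr natrD.
  have [] := base_product_hyperbolic delta hypS (V (next g (i.+1 * p)%N))
    (V (next g (i * p)%N)) (V (next g ((i + j.+1) * p)%N)); lra.
move=> i j le_ij; apply: le_trans (_ : (len g)%:R + (i * p)%:R - (C + delta) <= _).
  by rewrite lerD2r lerD2l ler_nat leq_pmulr.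
by have := chain (j - i)%N i; rewrite subnKC.
Qed.

Lemma vertex_ray_diverges (g : G) (z : nat -> G) (C : R) :
  (forall i j, (i <= j)%N -> (len g)%:R + i%:R - C <= gp (V (z i)) (V (z j))) ->
  diverges (V \o z).
Proof.
move=> zC; apply/asymptoticP => r; pose N := Num.bound `|r + C|; exists N => i j Ni Nj.
have large (k : nat) : (N <= k)%N -> r <= (len g)%:R + k%:R - C.
  rewrite -(ler_nat R); have := archi_boundP (normr_ge0 (r + C)).
  by have := ler_norm (r + C); have : 0 <= (len g)%:R :> R by []; lra.
case: (leqP i j) => [ij|/ltnW ji] /=.
  by apply: le_trans (zC i j ij); exact: large.
by rewrite (base_productC genS); apply: le_trans (zC j i ji); exact: large.
Qed.

(** As x and y are far apart, (x|y) is smaller than n - C - 2 * delta, so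
    hyperbolicity forces the Gromov products of the two rays to be at most about
    (x|y); the vertex v at height about (x|y) on a geodesic from the identity to x
    then lies near both rays, just where they part. *)
Lemma rays_part (C : R) (n : nat) (x y : G) (z z' : nat -> G) :
  0 <= C -> len x = n -> len y = n -> 2 * C + 4 * delta < (wd x y)%:R ->
  (forall i, n%:R - C <= gp (V x) (V (z i))) ->
  (forall i, n%:R - C <= gp (V y) (V (z' i))) ->
  exists2 v, word_ball S n v &
    forall i j, gromov_product d (V v) (V (z i)) (V (z' j)) <= 1 + 2 * C + 4 * delta.
Proof.
move=> C0 xn yn xy_far xz yz'; have delta0 := delta_ge0.
have wd_le : (wd x y <= n + n)%N.
  have := word_dist_triangle genS 1%g x y.
  by rewrite (word_distC genS x 1%g) !word_dist1g // xn yn.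
(* The Gromov product of x and y is n - wd x y / 2, here rounded down. *)
pose h := (n - uphalf (wd x y))%N.
have [h_le h_ge] : h%:R <= gp (V x) (V y) /\ gp (V x) (V y) <= h%:R + 1.
  rewrite (base_product_vertex genS) xn yn.
  have : (h.*2 + wd x y <= n + n <= h.*2 + wd x y + 2)%N by rewrite /h; lia.
  by rewrite -!(ler_nat R) !natrD -muln2 natrM; lra.
have hn : (h <= n)%N by exact: leq_subr.
have h_len : (h <= len x)%N by rewrite xn.
clearbody h.
have [v [vh vx]] := word_prefix genS x h h_len.
exists v; first by rewrite /word_ball /= vh.
move=> i j.
have vx_h : gp (V v) (V x) = h%:R by rewrite (base_product_vertex genS) vh vx natrB //; lra.
have len_n g : len g = n -> d (V 1%g) (V g) = n%:R by rewrite (dist_base_vertex genS) => ->.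
have vdist : d (V 1%g) (V v) = h%:R by rewrite (dist_base_vertex genS) vh.
have h_n : h%:R <= n%:R :> R by rewrite ler_nat.
have vz : d (V v) (V (z i)) <= d (V 1%g) (V (z i)) - h%:R + 2 * C.
  apply: le_trans (cayley_dist_triangle genS (V x) _ _) _.
  rewrite (cayley_distE (V v)) (cayley_distE (V x)) vx_h vdist (len_n x xn).
  by have := xz i; lra.
have vz' : d (V v) (V (z' j)) <= d (V 1%g) (V (z' j)) - h%:R + 2 * C + 4 * delta.
  rewrite (cayley_distE (V v)) vdist; have := yz' j.
  have [] := base_product_hyperbolic delta hypS (V x) (V v) (V y);
  have [] := base_product_hyperbolic delta hypS (V y) (V v) (V (z' j)); lra.
have zz' : gp (V (z i)) (V (z' j)) <= h%:R + 1 + 2 * delta.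
  have := xz i; have := yz' j; rewrite (base_productC genS (V y)).
  have xyE : gp (V x) (V y) = n%:R - (wd x y)%:R / 2.
    by rewrite (base_product_vertex genS) xn yn; lra.
  have [] := base_product_hyperbolic delta hypS (V (z i)) (V x) (V (z' j));
  have [] := base_product_hyperbolic delta hypS (V (z' j)) (V x) (V y); lra.
by rewrite /gromov_product (cayley_distE (V (z i))); lra.
Qed.

Context (eta : R) (eta_visual : visual_parameter S delta eta).

(** The rays issued from an M-separated net of the sphere give pairwise separated
    boundary points, and the balls of radius M around the net cover the sphere. *)
Lemma sphere_le_max_separated : finite_set S ->
  exists2 theta : R, 0 < theta & exists M : nat, forall n (s : seq G),
    uniq s -> {in s, forall g, len g = n} ->
    exists2 k : nat, (size s <= k * @ball_size G S M)%N &
      (k%:R%:E <= max_separated S eta theta n)%E.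
Proof.
move=> finS; have [C [C0 /choice[z zC]]] := escaping_ray.
have delta0 := delta_ge0; have [eta0 eta1 _ visual_bounds] := eta_visual.
set eta' := expR _ - 1 in eta1 visual_bounds.
pose r : R := 1 + 2 * C + 4 * delta + 2 * delta.
pose theta : R := (1 - 2 * eta') * expR (- (eta * r)).
have theta0 : 0 < theta by rewrite mulr_gt0 ?expR_gt0 //; lra.
pose M := Num.bound (2 * C + 4 * delta).
have M_large : 2 * C + 4 * delta < M%:R by apply: archi_boundP; lra.
exists theta => //; exists M => n s us sn.
have [||t [ts ut t_sep s_near]] := exists_separated_net G (fun x y => (wd x y <= M)%N) s.
- by move=> x; rewrite /= (word_distgg genS).
- by move=> x y; rewrite /= (word_distC genS).
pose point_of g : set (nat -> X) := boundary_point (V \o z g).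
have rayE g : z g 0%N = g /\
    forall i j, (i <= j)%N -> (len g)%:R + i%:R - C <= gp (V (z g i)) (V (z g j)).
  exact: zC.
have point_ray g : point_of g (V \o z g).
  by split; apply: vertex_ray_diverges (rayE g).2.
have point_boundary g : boundary (point_of g).
  by apply: boundary_point_boundary; apply: vertex_ray_diverges (rayE g).2.
have near_ray g : g \in t -> forall i, n%:R - C <= gp (V g) (V (z g i)).
  move=> gt i; have [g0 /(_ 0%N i (leq0n _))] := rayE g.
  by rewrite g0 (sn _ (ts _ gt)) addr0.
have point_sep x y : x \in t -> y \in t -> x != y ->
    Defs.separated eta theta n (point_of x) (point_of y).
  move=> xt yt xy.
  have xy_far : 2 * C + 4 * delta < (wd x y)%:R.
    apply: lt_trans M_large _; rewrite ltr_nat ltnNge.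
    exact: t_sep.
  have [v vn v_part] := rays_part C n x y (z x) (z y) C0 (sn _ (ts _ xt)) (sn _ (ts _ yt))
    xy_far (near_ray _ xt) (near_ray _ yt).
  exists v^-1%g; first by rewrite /word_ball /= (word_lengthV genS).
  have b_x := boundary_act_boundary genS v^-1%g _ (point_boundary x).
  have b_y := boundary_act_boundary genS v^-1%g _ (point_boundary y).
  have [rho_le _] := andP (visual_bounds _ _ b_x b_y).
  apply: le_trans rho_le; rewrite ler_pM2l; last by lra.
  apply: le_visual_rho => //.
    apply: (le_boundary_product _ _ _ _ 0); [by exists (V \o z x)|by exists (V \o z y)|].
    by exists 0%N => i j _ _; exact: base_product_ge0.
  apply: (boundary_product_le genS delta delta_ge0 hypS _ _
    (translate v^-1%g \o (V \o z x)) (translate v^-1%g \o (V \o z y))) => //.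
  - by exists (V \o z x).
  - by exists (V \o z y).
  - by move=> i j /=; rewrite base_product_translate // invgK; exact: v_part.
exists (size t).
  rewrite -(size_allpairs (fun g h : G => (g * h)%g) t (fset_set (word_ball S M))).
  apply: uniq_leq_size => // g /s_near[h ht hg].
  by rewrite -(mulVKg h g); apply: allpairs_f => //; rewrite mem_ball.
apply: ereal_sup_ubound; exists (size t) => //.
exists [set point_of x | x in [set` t]].
  split=> [_ [x _ <-] //|_ _ [x xt <-] [y yt <-] xy].
  by apply: point_sep => //; apply/eqP => xyE; apply: xy; rewrite xyE.
rewrite card_eq_sym; apply/card_set_bijP; exists (fun i => point_of (nth 1%g t i)).
split=> [i it|i j|_ [x xt <-]].
- by exists (nth 1%g t i) => //; exact: mem_nth.
- rewrite !inE => it jt ijE; apply/eqP; rewrite -(nth_uniq 1%g it jt ut).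
  apply/negPn/negP => /point_sep; rewrite ijE => /(_ (mem_nth _ it) (mem_nth _ jt)).
  exact: not_separated_self.
- by exists (index x t); rewrite /= ?index_mem // nth_index.
Qed.

End LowerBound.

(** * Limits of exponential rates *)

Section Limits.
Context {R : realType}.

(** Fekete's lemma; monotonicity lets the remainder of the division of n by p
    be absorbed into one more block of length p. *)
Lemma fekete (u : nat -> R) :
  (forall n, 0 <= u n) -> {homo u : m n / (m <= n)%N >-> m <= n} ->
  (forall m n, u (m + n)%N <= u m + u n) ->
  cvgn (fun n => n%:R^-1 * u n).
Proof.
move=> u0 u_homo u_sub.
(* The term of index 0 is left out because 0^-1 = 0. *)
pose A := [set n.+1%:R^-1 * u n.+1 | n in [set: nat]].
have A0 : lbound A 0 by move=> _ [n _ <-]; rewrite mulr_ge0.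
have lbA : has_inf A by split; [exists (1%:R^-1 * u 1%N), 0%N|exists 0].
apply/cvg_ex; exists (inf A); apply/cvgrPdist_le => e e0.
have [_ [p' _ <-] p_e] : exists2 a, A a & a < inf A + e / 2.
  by apply: inf_adherent => //; rewrite divr_gt0.
set p := p'.+1 in p_e; have p_gt0 : 0 < p%:R :> R by rewrite ltr0n.
have blocks q : u (q * p)%N <= q%:R * u p + u 0%N.
  elim: q => [|q IHq]; first by rewrite mul0n mul0r add0r.
  by rewrite mulSnr -addn1 natrD mulrDl mul1r; apply: le_trans (u_sub _ _) _; lra.
have u_le n : u n <= (n%:R / p%:R + 2) * u p.
  rewrite {1}(divn_eq n p); apply: le_trans (u_sub _ _) _.
  have up_r : u (n %% p)%N <= u p by apply: u_homo; apply: ltnW; rewrite ltn_pmod.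
  have up_0 : u 0%N <= u p by apply: u_homo.
  have q_le : (n %/ p)%:R <= n%:R / p%:R :> R.
    by rewrite ler_pdivlMr // -natrM ler_nat leq_trunc_div.
  have := blocks (n %/ p)%N; have : (n %/ p)%:R * u p <= n%:R / p%:R * u p by rewrite ler_wpM2r.
  by lra.
exists (Num.bound (4 * u p / e)).+1 => // n /= n_large.
have n_gt0 : (0 < n)%N by exact: leq_trans n_large.
have n_gt0R : 0 < n%:R :> R by rewrite ltr0n.
have inf_le : inf A <= n%:R^-1 * u n.
  by apply: ge_inf; [exists 0|exists n.-1 => //; rewrite prednK].
have le_inf : n%:R^-1 * u n <= inf A + e.
  have -> : inf A + e = inf A + e / 2 + e / 2 by lra.
  apply: le_trans (_ : p%:R^-1 * u p + 2 * u p / n%:R <= _).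
    rewrite mulrC ler_pdivrMr // mulrDl.
    rewrite mulfVK ?gt_eqF // [X in _ <= X + _]mulrC mulrA -mulrDl.
    exact: u_le.
  apply: lerD; first exact: ltW.
  rewrite ler_pdivrMr //.
  have : 4 * u p / e < n%:R.
    apply: lt_le_trans (archi_boundP _) _; last by rewrite ler_nat ltnW.
    by rewrite divr_ge0 ?mulr_ge0 // ltW.
  by rewrite ltr_pdivrMr //; lra.
by rewrite distrC ger0_norm; lra.
Qed.

Lemma lne_homo (x y : \bar R) : (x <= y -> lne x <= lne y)%E.
Proof.
move=> xy; have [x0|x0] := leP x 0%E; first by rewrite le0_lneNy ?leNye.
by rewrite lee_lne // in_itv /= leey ?andbT; [exact: ltW|exact/ltW/(lt_le_trans x0)].
Qed.

(** Upper limits are compared along indices phi n that tend to infinity, since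
    relative growth looks only at spheres whose radius is a multiple of m. *)
Lemma limn_esup_le_along (u v : nat -> \bar R) (a : nat -> R) (phi : nat -> nat) :
  a n @[n --> \oo] --> 0 -> (forall n, (n <= phi n)%N) ->
  (forall n, u n <= (a n)%:E + v (phi n))%E -> (limn_esup u <= limn_esup v)%E.
Proof.
move=> a0 le_phi uv; apply/lee_addgt0Pr => e e0; rewrite -leeBlDr //.
apply: le_ereal_inf_tmp => _ [V [N _ NV] <-]; rewrite leeBlDr //.
have [M _ Ma] : \forall n \near \oo, a n <= e.
  by near=> n; apply: ltW; near: n; exact: cvgr_lt e0.
apply: le_trans (ereal_inf_lbound _) _.
  by exists [set n | (maxn N M <= n)%N] => //; exists (maxn N M).
apply: ge_ereal_sup => _ [n /= + <-]; rewrite geq_max => /andP[Nn Mn].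
apply: le_trans (uv n) _; rewrite addeC; apply: leeD; last by rewrite lee_fin; exact: Ma.
by apply: ereal_sup_ubound; exists (phi n) => //; apply: NV => /=; exact: leq_trans (le_phi n).
Unshelve. all: by end_near. Qed.

Lemma cvg_div_nat0 (c : R) (phi : nat -> nat) : (forall n, (n <= phi n)%N) ->
  (phi n)%:R^-1 * c @[n --> \oo] --> 0.
Proof.
move=> le_phi; apply/cvgr0Pnorm_le => e e0.
exists (Num.bound (`|c| / e)).+1 => // n /= n_large.
have phi_large : (Num.bound (`|c| / e) < phi n)%N by exact: leq_trans (le_phi n).
have phi_gt0 : 0 < (phi n)%:R :> R by rewrite ltr0n; exact: leq_trans phi_large.
rewrite normrM ger0_norm ?invr_ge0 // mulrC ler_pdivrMr // mulrC -ler_pdivrMr //.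
apply: le_trans (ltW (archi_boundP _)) _; first by rewrite divr_ge0 // ltW.
by rewrite ler_nat ltnW.
Qed.

End Limits.

(** * Entropy and growth *)

Section Entropy.
Context {R : realType} {G : groupType} {S : set G} (genS : symmetric_generating_set S)
  (finS : finite_set S).
Context (delta : R) (delta_ge0 : 0 <= delta)
  (hypS : hyperbolic (@cayley_dist R G S) delta)
  (eta : R) (eta_visual : visual_parameter S delta eta).

Local Notation b := (@ball_size G S).

Lemma growth_rate_cvg : n%:R^-1 * ln (b n)%:R @[n --> \oo] --> growth_rate R S.
Proof.
have b_pos n : 0 < (b n)%:R :> R by rewrite ltr0n; exact: ball_size_gt0.
apply: fekete => [n|m n mn|m n].
- by rewrite ln_ge0 // ler1n; exact: ball_size_gt0.
- by rewrite ler_ln ?posrE // ler_nat; exact: ball_size_homo.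
- by rewrite -lnM ?posrE // ler_ln ?posrE ?mulr_gt0 // -natrM ler_nat; exact: ball_sizeD.
Qed.

Definition entropy_at (theta : R) : \bar R :=
  limn_esup (fun n => (n%:R^-1)%:E * lne (max_separated S eta theta n))%E.

Lemma entropy_at_homo (theta theta' : R) :
  theta <= theta' -> (entropy_at theta' <= entropy_at theta)%E.
Proof.
move=> le_theta; apply: (limn_esup_le_along _ _ (fun=> 0) id) => // [|n]; first exact: cvg_cst.
rewrite add0e; apply: lee_wpmul2l; first by rewrite lee_fin.
apply: lne_homo; apply: le_ereal_sup => _ [k [A [Ab Asep] Ak] <-].
exists k => //; exists A => //; split=> // xi zeta Axi Azeta ne.
by have [g gn le_g] := Asep xi zeta Axi Azeta ne; exists g => //; exact: le_trans le_g.
Qed.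

(** A smaller theta separates more points, so the limit as theta tends to 0 is a
    supremum, to be bounded at each theta or from below by a single theta. *)
Lemma boundary_entropyE :
  boundary_entropy S eta = ereal_sup [set entropy_at theta | theta in [set theta | 0 < theta]].
Proof.
have -> : [set theta : R | 0 < theta] = [set` Interval (BRight 0) +oo%O].
  by apply/seteqP; split=> theta /=; rewrite in_itv /= andbT.
apply: cvg_lim => //; apply: nonincreasing_at_right_cvge => // t t' _ _.
exact: entropy_at_homo.
Qed.

Lemma entropy_le_growth_rate : (boundary_entropy S eta <= (growth_rate R S)%:E)%E.
Proof.
rewrite boundary_entropyE; apply: ge_ereal_sup => _ [theta /= theta0 <-].
have [c sep_le] := max_separated_le genS delta hypS eta eta_visual theta finS theta0.
have b_pos n : 0 < (b n)%:R :> R by rewrite ltr0n; exact: ball_size_gt0.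
have lim_growth : ((n%:R^-1 * ln (b n)%:R)%:E @[n --> \oo] --> (growth_rate R S)%:E)%E.
  by apply: cvg_EFin; [exact: nearW|exact: growth_rate_cvg].
rewrite -(cvg_lim _ lim_growth) // -is_cvg_limn_esupE; last first.
  by apply/cvg_ex; eexists; exact: lim_growth.
apply: (limn_esup_le_along _ _ (fun n => n%:R^-1 * ln (b c)%:R) id) => // [|n].
  exact: (cvg_div_nat0 _ id).
rewrite -EFinD -mulrDr EFinM; apply: lee_wpmul2l; first by rewrite lee_fin.
apply: le_trans (lne_homo _ _ (sep_le n)) _; rewrite lne_EFin // lee_fin addrC.
by rewrite -lnM ?posrE // ler_ln ?posrE ?mulr_gt0 // -natrM ler_nat; exact: ball_sizeD.
Qed.

Context (c0 : R) (c0_gt1 : 1 < c0)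
  (c0_extends : forall g : G, exists g' : G,
     (word_dist S g g')%:R <= c0 /\ word_length S g' = (word_length S g + 1)%N).

(** A set counted by the relative growth lies in the sphere of radius m * n, whose
    size is at most a constant times the number of separated boundary points. *)
Lemma rel_growth_le_entropy (m : nat) (epsilon lambda : R) : (0 < m)%N ->
  (rel_growth_at S m epsilon lambda <= boundary_entropy S eta)%E.
Proof.
move=> m0; have [theta theta0 [M net]] := sphere_le_max_separated genS delta delta_ge0 hypS
  c0 c0_gt1 c0_extends eta eta_visual finS.
rewrite boundary_entropyE; apply: le_trans (ereal_sup_ubound _); last by exists theta.
have mn n : (n <= m * n)%N by rewrite leq_pmull.
apply: (limn_esup_le_along _ _ (fun n => (m * n)%:R^-1 * ln (b M)%:R) (muln m)) => // [|n].
  exact: (cvg_div_nat0 _ (muln m)).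
rewrite EFinM -muleDr ?fin_num_adde_defr //; apply: lee_wpmul2l; first by rewrite lee_fin.
have bM0 : 0 < (b M)%:R :> R by rewrite ltr0n; exact: ball_size_gt0.
pose s := [seq g <- fset_set (word_ball S (m * n)) | word_length S g == (m * n)%N].
have [||k s_le k_le] := net (m * n)%N s.
- by rewrite filter_uniq ?fset_uniq.
- by move=> g; rewrite mem_filter => /andP[/eqP].
have rel_le : (max_rel_separated S n m epsilon lambda <= (k%:R * (b M)%:R)%:E)%E.
  apply: ge_ereal_sup => _ [j [A [A_sphere _] Aj] <-].
  rewrite lee_fin -natrM ler_nat; apply: leq_trans s_le.
  have finA : finite_set A by apply/finite_setP; exists j.
  rewrite -(card_fset_set Aj); apply: uniq_leq_size => // g.
  rewrite in_fset_set // => /set_mem /A_sphere gE.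
  by rewrite mem_filter mem_ball // gE eqxx leqnn.
apply: le_trans (lne_homo _ _ rel_le) _.
have [->|k0] := posnP k; first by rewrite mul0r le0_lneNy ?leNye.
have k0R : 0 < k%:R :> R by rewrite ltr0n.
rewrite lne_EFin; last exact: mulr_gt0.
rewrite lnM ?posrE // addrC EFinD leeD2l //.
by rewrite -lne_EFin //; exact: lne_homo.
Qed.

End Entropy.

Theorem mainTheorem1 (R : realType) (G : groupType) (S : set G)
    (G_infinite : infinite_set [set: G])
    (S_finite : finite_set S)
    (S_generates : symmetric_generating_set S)
    (delta : R) (delta_ge0 : 0 <= delta)
    (G_hyperbolic : hyperbolic (@cayley_dist R G S) delta)
    (c0 : R) (c0_gt1 : 1 < c0)
    (c0_extends : forall g : G, exists g' : G,
       (word_dist S g g')%:R <= c0 /\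
       word_length S g' = (word_length S g + 1)%N)
    (D : R) (D_ge0 : 0 <= D)
    (D_stable : stability_constant (@cayley_dist R G S) c0 D)
    (eta : R) (eta_visual : visual_parameter S delta eta) :
  let tau := fun lambda : R => 4 * (D + delta) / (1 - lambda) in
  let mu := fun lambda epsilon : R => lambda * epsilon / (c0 - 1) in
  (rel_growth_rate S mu tau <= boundary_entropy S eta)%E /\
  (boundary_entropy S eta <= (growth_rate R S)%:E)%E.
Proof.
move=> tau mu; split; last exact: (entropy_le_growth_rate S_generates S_finite delta).
apply: ge_ereal_sup => _ [lambda [epsilon [m [_ _ [m0 _] ->]]]].
exact: (rel_growth_le_entropy S_generates S_finite delta delta_ge0 G_hyperbolic eta
  eta_visual c0).
Qed.
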